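(* Let $\mathcal X=\bigcup_{i\in\mathbb N}\{x_i,x_i'\}$ (all these points distinct), with improvement sets $\Delta(x_i)=\{x_i,x_i'\}$ and $\Delta(x_i')=\{x_i'\}$ for all $i$. Let $\mathcal H\subseteq\{0,1\}^{\mathcal X}$ be such that every $h\in\mathcal H$ satisfies $h(x_i')=1$ for all $i$, and $\mathcal H$ realizes every labeling of $\{x_1,x_2,\dots\}$. Then $\mathcal H$ has infinite Littlestone dimension; however, in the realizable online learning with improvement game, the learner that at each round implements $g$ with $g(x_i)=0$ and $g(x_i')=1$ for all $i$ never makes a mistake.
   Context: Labels are $\mathcal Y=\{0,1\}$ with $1$ preferred to $0$. Best response: for $h:\mathcal X\to\{0,1\}$ and $x\in\mathcal X$ let $\Delta_h^+(x)=\{x'\in\Delta(x):h(x')=1\}$, and let $\Delta_h(x)=\Delta_h^+(x)$ if $h(x)=0$ and $\Delta_h^+(x)\neq\emptyset$, and $\Delta_h(x)=\{x\}$ otherwise. Game: at each round $t$, the environment presents $x^{(t)}\in\mathcal X$; the learner implements $h^{(t)}:\mathcal X\to\{0,1\}$; the agent moves to some $v^{(t)}\in\Delta_{h^{(t)}}(x^{(t)})$ (chosen adversarially); the environment selects $y^{(t)}\in\{0,1\}$; the learner makes a mistake iff $h^{(t)}(v^{(t)})\neq y^{(t)}$. A run is realizable by $\mathcal H$ if there is $h^*\in\mathcal H$ with $h^*(v^{(t)})=y^{(t)}$ for all $t$. The Littlestone dimension of $\mathcal H$ is the maximum depth $d$ of a complete binary tree, with internal nodes labeled by points of $\mathcal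 X$ and the two outgoing edges of a node labeled $x$ being labeled $(x,0)$ and $(x,1)$, such that the edge labels along every root-to-leaf path are realized by some $h\in\mathcal H$ (infinite if such trees of arbitrarily large depth exist). *)

(* Defs.v *)
From mathcomp Require Import all_boot.
From mathcomp Require Import boolp classical_sets.

Set Implicit Arguments.
Unset Strict Implicit.
Unset Printing Implicit Defensive.

Local Open Scope classical_set_scope.

Section LittlestoneDimension.
Variable X : Type.

Inductive ltree : Type :=
| Leaf
| Node of X & ltree & ltree.

Fixpoint complete (d : nat) (t : ltree) : Prop :=
  match d, t with
  | 0, Leaf => True
  | d'.+1, Node _ l r => complete d' l /\ complete d' r
  | _, _ => False
  end.

(* The sequences of edge labels read along the root-to-leaf paths; the left
   edge of a node labeled x carries (x, 0) and the right edge carries (x, 1). *)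
Fixpoint branches (t : ltree) : set (seq (X * bool)) :=
  match t with
  | Leaf => [set [::]]
  | Node x l r =>
      (cons (x, false) @` branches l) `|` (cons (x, true) @` branches r)
  end.

Definition realizes (h : X -> bool) (p : seq (X * bool)) : Prop :=
  [seq h e.1 | e <- p] = [seq e.2 | e <- p].

Definition shattered (H : set (X -> bool)) (t : ltree) : Prop :=
  forall p, branches t p -> exists2 h, H h & realizes h p.

Definition shatters_depth (H : set (X -> bool)) (d : nat) : Prop :=
  exists2 t, complete d t & shattered H t.

(* [None] stands for an infinite dimension. The empty class, which shatters
   not even the tree of depth 0, is given no dimension. *)
Definition is_littlestone_dim (H : set (X -> bool)) (D : option nat) : Prop :=
  match D with
  | Some d =>
      shatters_depth H d /\ (forall d', shatters_depth H d' -> d' <= d)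
  | None => forall n, exists2 d, n <= d & shatters_depth H d
  end.

End LittlestoneDimension.

Section ImprovementGame.
Variables (X : Type) (Delta : X -> set X).

Definition improving (h : X -> bool) (x : X) : set X :=
  [set x' | Delta x x' /\ h x' = true].

Definition best_response (h : X -> bool) (x : X) : set X :=
  if ~~ h x && `[< improving h x !=set0 >] then improving h x else [set x].

Record round : Type := Round {
  presented : X;
  moved : X;
  label : bool
}.

(* A learner picks its next classifier from the past rounds and the point
   presented in the current one. *)
Definition learner : Type := seq round -> X -> X -> bool.

Definition implemented (L : learner) (r : nat -> round) (t : nat) : X -> bool :=
  L (mkseq r t) (presented (r t)).

(* Only the rounds t < T are played. Since T is arbitrary, a property of every
   round of every such run also holds along infinite runs. No strategy is
   imposed on the environment or on the agent's tie-breaking, so quantifying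
   over runs accounts for adaptive adversaries. *)
Definition is_run (L : learner) (T : nat) (r : nat -> round) : Prop :=
  forall t, t < T ->
    best_response (implemented L r t) (presented (r t)) (moved (r t)).

Definition realizable (H : set (X -> bool)) (T : nat) (r : nat -> round) :
    Prop :=
  exists2 h, H h & forall t, t < T -> h (moved (r t)) = label (r t).

Definition mistake (L : learner) (r : nat -> round) (t : nat) : Prop :=
  implemented L r t (moved (r t)) <> label (r t).

Definition never_errs (H : set (X -> bool)) (L : learner) : Prop :=
  forall T r, is_run L T r -> realizable H T r ->
    forall t, t < T -> ~ mistake L r t.

Definition constant_learner (g : X -> bool) : learner := fun _ _ => g.

End ImprovementGame.

(* [Base i] is x_i and [Improved i] is x_i'. *)
Inductive paired_point : Type :=
| Base of nat
| Improved of nat.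

Definition pair_improvements (x : paired_point) : set paired_point :=
  match x with
  | Base i => [set Base i; Improved i]
  | Improved i => [set Improved i]
  end.

(* Main.v *)
Require Import Defs.
From mathcomp Require Import all_boot.
From mathcomp Require Import boolp classical_sets.

(** Labeling every node at depth [i] by [x_i] gives complete trees of any depth
whose branches are labelings of an initial segment of [x_0, x_1, ...]. In the
game, [x_i] always improves to [x_i'] under [g], so the agent is only ever
observed at points [x_i'], where [g] and every hypothesis take the value 1. *)

Fixpoint level_tree {X : Type} (x : nat -> X) (k d : nat) : ltree X :=
  if d is d'.+1 then
    Node (x k) (level_tree x k.+1 d') (level_tree x k.+1 d')
  else Leaf X.

Lemma complete_level_tree (X : Type) (x : nat -> X) (d k : nat) :
  complete d (level_tree x k d).
Proof. by elim: d k => [|d IHd] k //=; split; apply: IHd. Qed.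

(** A branch meets [x k], [x k.+1], ... once per index, so its edge labels define a function [b] of
    the index. The offset [k] lets the induction pass to subtrees. *)
Lemma level_tree_branch_labeling (X : Type) (x : nat -> X) (d k : nat)
    (p : seq (X * bool)) :
  branches (level_tree x k d) p ->
  exists b : nat -> bool, forall h : X -> bool,
    (forall i, k <= i -> h (x i) = b i) -> realizes h p.
Proof.
elim: d k p => [|d IHd] k p /=; first by move=> ->; exists xpredT.
have extend c q : branches (level_tree x k.+1 d) q ->
    exists b : nat -> bool, forall h : X -> bool,
      (forall i, k <= i -> h (x i) = b i) -> realizes h ((x k, c) :: q).
  (* The tail [q] involves only indices above [k], so the value at [k] is free to record the root
     edge [c]. *)
  move=> /IHd [b realizes_q]; exists (fun i => if i == k then c else b i).
  move=> h h_eq; rewrite /realizes /= h_eq // eqxx; congr (_ :: _).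
  apply: realizes_q => i lt_ki.
  by rewrite h_eq ?(ltnW lt_ki) // gtn_eqF.
by case=> -[q branch_q <-]; apply: extend.
Qed.

Lemma littlestone_dim_infinite (X : Type) (H : set (X -> bool))
    (x : nat -> X) :
  (forall b : nat -> bool, exists2 h, H h & forall i, h (x i) = b i) ->
  is_littlestone_dim H None.
Proof.
move=> H_x n; exists n => //; exists (level_tree x 0 n).
  exact: complete_level_tree.
move=> p /level_tree_branch_labeling [b realizes_p].
have [h Hh h_eq] := H_x b.
by exists h => //; apply: realizes_p => i _; apply: h_eq.
Qed.

(** [Improved i] is already accepted by [g] and stays put; [Base i] is rejected and has [Improved i]
    as its only improvement. *)
Lemma best_response_improved (g : paired_point -> bool) (x v : paired_point) :
  (forall i, g (Base i) = false) -> (forall i, g (Improved i) = true) ->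
  best_response pair_improvements g x v -> exists i, v = Improved i.
Proof.
move=> g_base g_improved; rewrite /best_response.
case: x => i; last by rewrite g_improved /= => ->; exists i.
rewrite g_base /=; case: asboolP => [_ [_] | no_improvement].
  by case: v => j; [rewrite g_base | exists j].
(* Staying at [Base i] would require an empty improving set, but [Improved i] belongs to it. *)
by case: no_improvement; exists (Improved i); split; [right |].
Qed.

Theorem mainTheorem7 (H : set (paired_point -> bool))
    (H_improved : forall h, H h -> forall i, h (Improved i) = true)
    (H_base : forall b : nat -> bool,
        exists2 h, H h & forall i, h (Base i) = b i) :
  is_littlestone_dim H None /\
  (forall g : paired_point -> bool,
      (forall i, g (Base i) = false) ->
      (forall i, g (Improved i) = true) ->
      never_errs pair_improvements H (constant_learner g)).
Proof.
split; first exact: littlestone_dim_infinite H_base.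
move=> g g_base g_improved T r run [h Hh h_labels] t lt_tT; apply.
have [i moved_i] := best_response_improved _ _ _ g_base g_improved (run t lt_tT).
(* Realizability turns the label into the value of [h] at the observed point. *)
by rewrite -h_labels // moved_i (H_improved _ Hh); apply: g_improved.
Qed.
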